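(* Let $2 \le m \le n$ and $1 \le k \le m$. Let $P$ be a nonzero orthogonal projection on $\mathcal{H}_n \otimes \mathcal{H}_m$ (so $P = P^* = P^2$). Then \[ \|P\|_{S(k)} \ge \min\Big\{1, \frac{k}{\big\lceil \tfrac12\big(n+m-\sqrt{(n-m)^2 + 4\,\mathrm{rank}(P) - 4}\big)\big\rceil}\Big\} \] and \[ \|P\|_{S(k)} \ge \frac{(k-1)mn + (m-k)\,\mathrm{rank}(P)}{mn(m-1)}. \]
   Context: $\mathcal{H}_d = \mathbb{C}^d$ and $m\le n$. $SR$ denotes Schmidt rank, i.e. the number of nonzero singular values of the coefficient matrix of a vector in $\mathcal{H}_n\otimes\mathcal{H}_m$. For $1\le k\le m$, \[ \|X\|_{S(k)} := \sup\{|\langle w|X|v\rangle| : |v\rangle,|w\rangle \text{ unit vectors}, SR(|v\rangle),SR(|w\rangle)\le k\}. \] *)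

(* Defs.v *)
From mathcomp Require Import all_boot all_algebra.
From mathcomp Require Export complex.
From mathcomp Require Import classical_sets reals.
Set Implicit Arguments. Unset Strict Implicit. Unset Printing Implicit Defensive.
Import GRing.Theory Num.Theory.
Local Open Scope ring_scope.
Local Open Scope complex_scope.

(* Vectors of H_n (x) H_m = C^(n*m) are row vectors 'rV_(n*m); the basis
   vector e_i (x) f_j has index mxvec_index i j, so the coefficient matrix
   of v is vec_mx v : 'M_(n,m). Operators are 'M_(n*m). *)

Definition mxadj (R : realType) (p q : nat) (A : 'M[R[i]]_(p, q)) : 'M[R[i]]_(q, p) :=
  (map_mx conjc A)^T.

Definition braket (R : realType) (N : nat) (w : 'rV[R[i]]_N) (X : 'M[R[i]]_N)
  (v : 'rV[R[i]]_N) : R[i] :=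
  (map_mx conjc w *m X *m v^T) 0 0.

Definition unit_vec (R : realType) (N : nat) (v : 'rV[R[i]]_N) : Prop :=
  \sum_(j < N) `|v 0 j| ^+ 2 = 1.

Definition schmidt_rank (R : realType) (n m : nat) (v : 'rV[R[i]]_(n * m)) : nat :=
  \rank (vec_mx v : 'M[R[i]]_(n, m)).

Arguments schmidt_rank {R} n m v.

Definition SNorm (R : realType) (n m k : nat) (X : 'M[R[i]]_(n * m)) : R :=
  sup [set x : R | exists v w : 'rV[R[i]]_(n * m),
         [/\ unit_vec v, unit_vec w, (schmidt_rank n m v <= k)%N,
             (schmidt_rank n m w <= k)%N & x%:C = `|braket w X v| ] ].

Arguments SNorm {R} n m k X.

(* Main.v *)
(* Linear subspaces and low rank (first bound): if a subspace L of n x m complex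
   matrices has dimension > (n - t)(m - t), it contains a nonzero matrix of rank
   <= t.  Instead of the projective dimension theorem, use a second-variation
   argument.  If L contains no such matrix, let psi have kernel L and let X
   minimise |psi X|^2 / |X|^2 among the matrices of rank <= t; the minimum is
   positive.  With s = rank X, passing to the (n - s) x (m - s) corner
   complementary to X, induction gives a nonzero U in L whose corner has rank
   <= t - s.  Then X + zU + z^2 W has rank <= t for all z and a suitable W, and
   averaging over z in {e, -e, ie, -ie} leaves psi X unchanged up to O(e^4) while
   adding e^2 |U|^2 to |X|^2, contradicting minimality.  So the range of P
   contains a unit vector v with SR(v) <= t; averaging the k-term truncations of
   a Schmidt-type decomposition of v gives the bound k / t.

   Second bound: restrict the columns of the coefficient matrix of P e_a to
   a k-subset S of the m columns, and average <w|P|w> and <w|w> over all S and a.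
   A fixed index lies in 'C(m-1, k-1) subsets and a pair in 'C(m-2, k-2), which
   interpolates between sum_ab |P_ab|^2 = rank P and
   sum_a |P_aa|^2 >= (rank P)^2 / (mn). *)

Require Import Defs.
From mathcomp Require Import all_boot all_order all_algebra.
From mathcomp Require Import complex spectral.
From mathcomp Require Import boolp classical_sets reals topology normedtype derive.
From mathcomp Require Import ring lra zify.
Import Order.TTheory GRing.Theory Num.Theory.
Import numFieldNormedType.Exports.
Local Open Scope ring_scope.
Local Open Scope complex_scope.

Set Implicit Arguments.
Unset Strict Implicit.
Unset Printing Implicit Defensive.

(** * Frobenius norms, adjoints and orthogonal projections *)

Section Frobenius.
Variable R : realType.
Local Notation C := R[i].
Local Notation Re := (@complex.Re R).
Local Notation Im := (@complex.Im R).

(** The norm on [R[i]] takes its values in [R[i]]; this squared modulus lies in [R], where order,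
    suprema and topology are at hand. *)
Definition sqmod (z : C) : R := Re z ^+ 2 + Im z ^+ 2.

Definition sqnorm p q (X : 'M[C]_(p, q)) : R := \sum_i \sum_j sqmod (X i j).

Lemma sqmodE (z : C) : (sqmod z)%:C = z * conjc z.
Proof. by rewrite -sqr_normc -add_Re2_Im2. Qed.

Lemma sqmod_ge0 (z : C) : 0 <= sqmod z.
Proof. by rewrite addr_ge0 ?sqr_ge0. Qed.

Lemma sqmod_eq0 (z : C) : (sqmod z == 0) = (z == 0).
Proof.
by rewrite paddr_eq0 ?sqr_ge0 // !sqrf_eq0; case: z => a b; rewrite eq_complex.
Qed.

Lemma sqmodM (y z : C) : sqmod (y * z) = sqmod y * sqmod z.
Proof. by case: y => a b; case: z => c d; rewrite /sqmod /=; ring. Qed.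

Lemma sqnorm_ge0 p q (X : 'M_(p, q)) : 0 <= sqnorm X.
Proof. by apply: sumr_ge0 => i _; apply: sumr_ge0 => j _; apply: sqmod_ge0. Qed.

Lemma sqnorm_eq0 p q (X : 'M_(p, q)) : (sqnorm X == 0) = (X == 0).
Proof.
apply/idP/eqP=> [|->].
  rewrite psumr_eq0 => [/allP X0|i _]; last first.
    by apply: sumr_ge0 => j _; apply: sqmod_ge0.
  apply/matrixP=> i j; have := X0 i (mem_index_enum _).
  rewrite /= psumr_eq0 => [/allP/(_ j (mem_index_enum _))|*]; last exact: sqmod_ge0.
  by rewrite /= sqmod_eq0 mxE => /eqP.
by apply/eqP; rewrite /sqnorm !big1 // => i _; rewrite big1 // => j _; apply/eqP;
  rewrite sqmod_eq0 mxE.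
Qed.

Lemma sqnorm_gt0 p q (X : 'M_(p, q)) : (0 < sqnorm X) = (X != 0).
Proof. by rewrite lt0r sqnorm_ge0 sqnorm_eq0 andbT. Qed.

Lemma sqnormZ p q (z : C) (X : 'M_(p, q)) : sqnorm (z *: X) = sqmod z * sqnorm X.
Proof.
rewrite /sqnorm mulr_sumr; apply: eq_bigr => i _.
by rewrite mulr_sumr; apply: eq_bigr => j _; rewrite mxE sqmodM.
Qed.

Lemma exists_normalizing_scalar p q (X : 'M[C]_(p, q)) :
  X != 0 -> exists z : C, sqmod z * sqnorm X = 1.
Proof.
rewrite -sqnorm_gt0 => X0; exists (Num.sqrt (sqnorm X)^-1)%:C.
by rewrite /sqmod /= sqr_sqrtr ?invr_ge0 ?ltW // expr0n addr0 mulVf // gt_eqF.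
Qed.

Lemma sqnorm_parallelogram p q (X Y : 'M_(p, q)) :
  sqnorm (X + Y) + sqnorm (X - Y) = 2 * sqnorm X + 2 * sqnorm Y.
Proof.
rewrite /sqnorm !mulr_sumr -!big_split; apply: eq_bigr => i _ /=.
rewrite !mulr_sumr -!big_split; apply: eq_bigr => j _ /=; rewrite !mxE.
by case: (X i j) => a b; case: (Y i j) => c d; rewrite /sqmod /=; ring.
Qed.

Lemma sqnorm_mxvec p q (X : 'M_(p, q)) : sqnorm (mxvec X) = sqnorm X.
Proof.
rewrite /sqnorm big_ord1 pair_bigA.
rewrite (reindex _ (curry_mxvec_bij p q)) /=.
by apply: eq_bigr => -[i j] _ /=; rewrite mxvecE.
Qed.

Lemma mxadjM p q r (X : 'M[C]_(p, q)) (Y : 'M_(q, r)) :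
  mxadj (X *m Y) = mxadj Y *m mxadj X.
Proof. by rewrite /mxadj map_mxM trmx_mul. Qed.

Lemma mxadjK p q (X : 'M[C]_(p, q)) : mxadj (mxadj X) = X.
Proof. by apply/matrixP=> i j; rewrite !mxE conjcK. Qed.

Lemma mxadj1 p : mxadj (1%:M : 'M[C]_p) = 1%:M.
Proof. by rewrite /mxadj map_mx1 trmx1. Qed.

Lemma mxadjD p q (X Y : 'M[C]_(p, q)) : mxadj (X + Y) = mxadj X + mxadj Y.
Proof. by rewrite /mxadj map_mxD linearD. Qed.

Lemma mxadjB p q (X Y : 'M[C]_(p, q)) : mxadj (X - Y) = mxadj X - mxadj Y.
Proof. by rewrite /mxadj map_mxB linearB. Qed.

Lemma sqnormE p q (X : 'M_(p, q)) : (sqnorm X)%:C = \tr (X *m mxadj X).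
Proof.
rewrite rmorph_sum; apply: eq_bigr => i _.
rewrite rmorph_sum mxE; apply: eq_bigr => j _.
by rewrite !mxE -sqmodE.
Qed.

Lemma sqnorm_rows p q (X : 'M_(p, q)) : sqnorm X = \sum_i sqnorm (row i X).
Proof.
by apply: eq_bigr => i _; rewrite /sqnorm big_ord1; apply: eq_bigr => j _; rewrite mxE.
Qed.

(** Expanding the trace form of the norm, both cross terms contain a product of [D] and [1%:M - D],
    which is zero. *)
Lemma pythagoras p q (D : 'M[C]_q) (X Y : 'M_(p, q)) :
  mxadj D = D -> D *m D = D ->
  sqnorm (X *m D + Y *m (1%:M - D)) = sqnorm (X *m D) + sqnorm (Y *m (1%:M - D)).
Proof.
move=> Dh DD; have : D *m (1%:M - D) = 0 by rewrite mulmxBr mulmx1 DD subrr.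
have : (1%:M - D) *m D = 0 by rewrite mulmxBl mul1mx DD subrr.
have : mxadj (1%:M - D) = 1%:M - D by rewrite mxadjB mxadj1 Dh.
move: (1%:M - D) => E Eh ED DE.
apply: (@complexI R); rewrite rmorphD /= !sqnormE mxadjD !mxadjM Dh Eh.
rewrite mulmxDl !mulmxDr !mxtraceD -!mulmxA (mulmxA D E) (mulmxA E D) DE ED.
by rewrite !mul0mx !mulmx0 !mxtrace0 addr0 add0r.
Qed.

Lemma sqnorm_isometry p q r (X : 'M[C]_(p, q)) (U : 'M_(q, r)) :
  U *m mxadj U = 1%:M -> sqnorm (X *m U) = sqnorm X.
Proof.
move=> UU; apply: (@complexI R).
by rewrite !sqnormE mxadjM mulmxA -(mulmxA X) UU mulmx1.
Qed.

Lemma sqnorm_split p q (D : 'M[C]_q) (X : 'M_(p, q)) :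
  mxadj D = D -> D *m D = D ->
  sqnorm X = sqnorm (X *m D) + sqnorm (X *m (1%:M - D)).
Proof.
by move=> Dh DD; rewrite -pythagoras // -mulmxDr [D + _]addrC subrK mulmx1.
Qed.

Lemma unit_vecE N (v : 'rV[C]_N) : unit_vec v <-> sqnorm v = 1.
Proof.
rewrite /unit_vec /sqnorm big_ord1; under eq_bigr => j _ do rewrite -add_Re2_Im2.
by rewrite -rmorph_sum /=; split=> [/complexI|->].
Qed.

(** Vectors are rows, so [P] acts on them by right multiplication with [P^T], which is again an
    orthogonal projection. *)
Lemma braket_proj N (P : 'M[C]_N) (w : 'rV_N) :
  mxadj P = P -> P *m P = P -> braket w P w = (sqnorm (w *m P^T))%:C.
Proof.
move=> Ph PP; have PTh : mxadj P^T = P^T by rewrite -{2}Ph /mxadj trmxK map_trmx trmxK.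
rewrite sqnormE mxadjM PTh mulmxA -(mulmxA w) -trmx_mul PP.
by rewrite /braket -mxtrace_tr !trmx_mul !trmxK mulmxA trace_mx11.
Qed.
End Frobenius.

(** * Continuity of complex matrix expressions *)

Section Continuity.
Variables (R : realType) (T : topologicalType).
Local Notation C := R[i].

(** Splitting into real and imaginary parts reduces everything to the topology of [R]. *)
Definition ccontinuous (h : T -> C) :=
  continuous (fun a => complex.Re (h a) : R) /\
  continuous (fun a => complex.Im (h a) : R).

Lemma ccontinuous_cst (c : C) : ccontinuous (fun=> c).
Proof. by split=> a; apply: cvg_cst. Qed.

Lemma ccontinuousD (h g : T -> C) :
  ccontinuous h -> ccontinuous g -> ccontinuous (fun a => h a + g a).
Proof.
move=> [h1 h2] [g1 g2]; split.
  have -> : (fun a => complex.Re (h a + g a) : R) =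
            (fun a => complex.Re (h a) + complex.Re (g a)).
    by apply/funext=> b; case: (h b) => ? ?; case: (g b).
  by move=> a; apply: cvgD; [apply: h1|apply: g1].
have -> : (fun a => complex.Im (h a + g a) : R) =
          (fun a => complex.Im (h a) + complex.Im (g a)).
  by apply/funext=> b; case: (h b) => ? ?; case: (g b).
by move=> a; apply: cvgD; [apply: h2|apply: g2].
Qed.

Lemma ccontinuousM (h g : T -> C) :
  ccontinuous h -> ccontinuous g -> ccontinuous (fun a => h a * g a).
Proof.
move=> [h1 h2] [g1 g2]; split.
  have -> : (fun a => complex.Re (h a * g a) : R) =
      (fun a => complex.Re (h a) * complex.Re (g a)
                - complex.Im (h a) * complex.Im (g a)).
    by apply/funext=> b; case: (h b) => ? ?; case: (g b).
  move=> a; apply: cvgB; apply: cvgM.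
  - exact: h1.
  - exact: g1.
  - exact: h2.
  - exact: g2.
have -> : (fun a => complex.Im (h a * g a) : R) =
    (fun a => complex.Re (h a) * complex.Im (g a)
              + complex.Im (h a) * complex.Re (g a)).
  by apply/funext=> b; case: (h b) => ? ?; case: (g b).
move=> a; apply: cvgD; apply: cvgM.
- exact: h1.
- exact: g2.
- exact: h2.
- exact: g1.
Qed.

Lemma ccontinuous_sum (I : finType) (P : pred I) (F : I -> T -> C) :
  (forall i, ccontinuous (F i)) -> ccontinuous (fun a => \sum_(i | P i) F i a).
Proof.
move=> Fc; elim: (index_enum I) => [|i s IH].
  by under eq_fun => a do rewrite big_nil; exact: ccontinuous_cst.
case Pi: (P i); under eq_fun => a do rewrite big_cons Pi.
  exact: ccontinuousD.
exact: IH.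
Qed.

Lemma ccontinuous_prod (I : finType) (P : pred I) (F : I -> T -> C) :
  (forall i, ccontinuous (F i)) -> ccontinuous (fun a => \prod_(i | P i) F i a).
Proof.
move=> Fc; elim: (index_enum I) => [|i s IH].
  by under eq_fun => a do rewrite big_nil; exact: ccontinuous_cst.
case Pi: (P i); under eq_fun => a do rewrite big_cons Pi.
  exact: ccontinuousM.
exact: IH.
Qed.

Definition mxcontinuous p q (h : T -> 'M[C]_(p, q)) :=
  forall i j, ccontinuous (fun a => h a i j).

Lemma mxcontinuous_cst p q (A : 'M[C]_(p, q)) : mxcontinuous (fun=> A).
Proof. by move=> i j; apply: ccontinuous_cst. Qed.

Lemma mxcontinuousM p q r (h : T -> 'M[C]_(p, q)) (g : T -> 'M[C]_(q, r)) :
  mxcontinuous h -> mxcontinuous g -> mxcontinuous (fun a => h a *m g a).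
Proof.
move=> hc gc i j; under eq_fun => a do rewrite mxE.
by apply: ccontinuous_sum => k; apply: ccontinuousM.
Qed.

Lemma mxcontinuous_det p (h : T -> 'M[C]_p) :
  mxcontinuous h -> ccontinuous (fun a => \det (h a)).
Proof.
move=> hc; apply: ccontinuous_sum => s; apply: ccontinuousM.
  exact: ccontinuous_cst.
by apply: ccontinuous_prod.
Qed.

Lemma continuous_sqmod (h : T -> C) :
  ccontinuous h -> continuous (fun a => sqmod (h a) : R).
Proof.
move=> [h1 h2] a; rewrite /sqmod; under eq_fun => b do rewrite !expr2.
by apply: cvgD; apply: cvgM; [exact: h1|exact: h1|exact: h2|exact: h2].
Qed.

Lemma continuous_sqnorm p q (h : T -> 'M[C]_(p, q)) :
  mxcontinuous h -> continuous (fun a => sqnorm (h a) : R).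
Proof.
move=> hc; suff [+ _] : ccontinuous (fun a => (sqnorm (h a))%:C) by [].
rewrite /sqnorm; under eq_fun => a do rewrite rmorph_sum.
apply: ccontinuous_sum => i; under eq_fun => a do rewrite rmorph_sum.
apply: ccontinuous_sum => j; split=> [|a]; last exact: cvg_cst.
exact: continuous_sqmod.
Qed.
End Continuity.

(** This turns a rank bound into polynomial equations, hence into a closed condition on [X]. *)
Lemma mxrank_leP (F : fieldType) p q t (X : 'M[F]_(p, q)) :
  (\rank X <= t)%N <->
  forall (A : 'M_(t.+1, p)) (B : 'M_(q, t.+1)), \det (A *m X *m B) = 0.
Proof.
split=> [rX A B|X0].
  apply/eqP; apply: contraLR rX => dn0; rewrite -ltnNge.
  have : A *m X *m B \in unitmx by rewrite unitmxE unitfE.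
  move=> /mxrank_unit <-; rewrite -mulmxA.
  exact: leq_trans (mxrankM_maxr _ _) (mxrankM_maxl _ _).
rewrite leqNgt; apply/negP=> rX.
(* If the rank exceeds [t], these two matrices cut an identity block of size [t.+1] out of the
   Gaussian normal form of [X]. *)
have := X0 (pid_mx t.+1 *m invmx (col_ebase X)) (invmx (row_ebase X) *m pid_mx t.+1).
rewrite -{2}[X]mulmx_ebase !mulmxA (mulmxKV (col_ebase_unit X)).
rewrite mulmxK ?row_ebase_unit //.
have lep := rank_leq_row X; have leq := rank_leq_col X.
rewrite !mul_pid_mx; have -> : minn q (minn (minn p (minn t.+1 (\rank X))) t.+1) = t.+1 by lia.
by rewrite pid_mx_1 det1 => /eqP; rewrite oner_eq0.
Qed.

(** * Existence of a minimiser among matrices of bounded rank *)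

Section Minimizer.
Local Open Scope classical_set_scope.
Variable R : realType.
Local Notation C := R[i].
Variables n m t : nat.

(** Real coordinates on the complex matrices: compactness is obtained in a real cube and transported
    along this map. *)
Definition complexify (a : 'rV[R]_(n * m + n * m)) : 'M[C]_(n, m) :=
  vec_mx (\row_j (a 0 (lshift _ j) +i* a 0 (rshift _ j))).

Lemma complexify_surj (X : 'M[C]_(n, m)) : exists a, complexify a = X.
Proof.
exists (row_mx (\row_j complex.Re (mxvec X 0 j)) (\row_j complex.Im (mxvec X 0 j))).
rewrite -[RHS]mxvecK; congr vec_mx; apply/rowP=> j.
by rewrite mxE row_mxEl row_mxEr !mxE; case: (mxvec X 0 j).
Qed.

Lemma complexify_continuous : mxcontinuous complexify.
Proof.
move=> i j; rewrite /complexify.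
split; under eq_fun => a do rewrite !mxE /=; exact: coord_continuous.
Qed.

Lemma sqnorm_complexify (a : 'rV[R]_(n * m + n * m)) :
  sqnorm (complexify a) = \sum_j (a 0 (lshift _ j) ^+ 2 + a 0 (rshift _ j) ^+ 2).
Proof.
rewrite /complexify -sqnorm_mxvec vec_mxK /sqnorm big_ord1.
by apply: eq_bigr => j _; rewrite mxE.
Qed.

Lemma coord_le_sqnorm (a : 'rV[R]_(n * m + n * m)) j : a 0 j ^+ 2 <= sqnorm (complexify a).
Proof.
rewrite sqnorm_complexify; case: (split_ordP j) => l ->;
  rewrite (bigD1 l) //= -addrA; [|rewrite addrCA]; rewrite lerDl;
  by rewrite addr_ge0 ?sqr_ge0 ?sumr_ge0 // => k _; rewrite addr_ge0 ?sqr_ge0.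
Qed.

Definition low_rank_sphere : set 'rV[R]_(n * m + n * m) :=
  [set a | sqnorm (complexify a) = 1 /\ (\rank (complexify a) <= t)%N].

Lemma low_rank_sphere_closed : closed low_rank_sphere.
Proof.
have -> : low_rank_sphere =
    [set a | sqnorm (complexify a) = 1] `&`
    \bigcap_(AB in [set: 'M[C]_(t.+1, n) * 'M[C]_(m, t.+1)])
      [set a | sqmod (\det (AB.1 *m complexify a *m AB.2)) = 0].
  apply/seteqP; split=> a /=.
    move=> [a1 /mxrank_leP ra]; split=> // AB _ /=.
    by apply/eqP; rewrite sqmod_eq0 ra.
  move=> [a1 ra]; split=> //; apply/mxrank_leP => A B.
  by apply/eqP; rewrite -sqmod_eq0; apply/eqP; apply: (ra (A, B)).
apply: closedI.
  apply: (@preimage_closed _ _ (fun a => sqnorm (complexify a) : R) [set 1]).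
    by move=> a _; apply: continuous_sqnorm; apply: complexify_continuous.
  exact: closed_eq.
apply: closed_bigI => -[A B] _ /=.
apply: (@preimage_closed _ _ (fun a => sqmod (\det (A *m complexify a *m B)) : R) [set 0]).
  move=> a _; apply: continuous_sqmod; apply: mxcontinuous_det.
  by do ?apply: mxcontinuousM; do ?exact: mxcontinuous_cst; exact: complexify_continuous.
exact: closed_eq.
Qed.

(** A closed subset of the cube with all coordinates in [-1, 1]. *)
Lemma low_rank_sphere_compact : compact low_rank_sphere.
Proof.
apply: (subclosed_compact low_rank_sphere_closed
  (rV_compact (fun=> @segment_compact R (-1) 1))).
move=> a [a1 _] j; rewrite /= in_itv /= -ler_norml.
by rewrite -(@ler_pXn2r _ 2) ?nnegrE // real_normK ?num_real // expr1n -a1 coord_le_sqnorm.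
Qed.

(** Rank bounds are invariant under scaling, so it suffices to minimise on the unit sphere. The
    comparison of quotients is cross-multiplied so that it also covers [Y = 0]. *)
Lemma low_rank_minimizer c (psi : 'M[C]_(n * m, c)) :
  (0 < t)%N -> (0 < n)%N -> (0 < m)%N ->
  exists X : 'M[C]_(n, m), [/\ X != 0, (\rank X <= t)%N &
    forall Y : 'M_(n, m), (\rank Y <= t)%N ->
      sqnorm (mxvec X *m psi) * sqnorm Y <= sqnorm (mxvec Y *m psi) * sqnorm X].
Proof.
move=> t0 n0 m0.
have low_rankZ (z : C) (Y : 'M[C]_(n, m)) :
    (\rank Y <= t)%N -> (\rank (z *: Y) <= t)%N.
  by apply: leq_trans; rewrite -mul_scalar_mx mxrankM_maxr.
have [] := @compact_EVT_min _ R (fun a => sqnorm (mxvec (complexify a) *m psi))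
  low_rank_sphere _ low_rank_sphere_compact.
(* The sphere is nonempty: a normalised matrix unit has rank at most 1, and [0 < t]. *)
- have D0 : delta_mx (Ordinal n0) (Ordinal m0) != 0 :> 'M[C]_(n, m).
    by apply/eqP => /matrixP/(_ (Ordinal n0) (Ordinal m0));
      rewrite !mxE !eqxx => /eqP; rewrite oner_eq0.
  have [z z1] := exists_normalizing_scalar D0.
  have [a aE] := complexify_surj (z *: delta_mx (Ordinal n0) (Ordinal m0)).
  exists a; split; rewrite aE ?sqnormZ //.
  by apply: low_rankZ; rewrite mxrank_delta.
- apply: continuous_subspaceT => a; apply: continuous_sqnorm.
  apply: mxcontinuousM; last exact: mxcontinuous_cst.
  move=> i j; case/mxvec_indexP: j => k l; rewrite (ord1 i).
  under eq_fun => b do rewrite mxvecE.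
  exact: complexify_continuous.
move=> a /set_mem [a1 ra] amin; exists (complexify a); split=> // [|Y rY].
  by rewrite -sqnorm_eq0 a1 oner_eq0.
have [->|Y0] := eqVneq Y 0.
  have s0 p q : sqnorm (0 : 'M[C]_(p, q)) = 0 by apply/eqP; rewrite sqnorm_eq0.
  by rewrite linear0 mul0mx !s0 mulr0 mul0r.
have [z z1] := exists_normalizing_scalar Y0.
have [b bE] := complexify_surj (z *: Y).
have Kb : b \in low_rank_sphere.
  by rewrite inE; split; rewrite bE ?sqnormZ //; apply: low_rankZ.
have := amin b Kb; rewrite bE [mxvec (z *: Y)]linearZ /= -scalemxAl sqnormZ a1 mulr1.
have sY : 0 <= sqnorm Y := sqnorm_ge0 Y.
move=> /(ler_wpM2r sY) /le_trans; apply.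
by rewrite mulrAC z1 mul1r.
Qed.
End Minimizer.

(** * Low-rank matrices in subspaces of large dimension *)

Section DimensionTheorem.
Variable R : realType.
Local Notation C := R[i].

(* Summing over z = e, -e, ie, -ie cancels the terms in z and z^2. *)
Lemma second_variation p q c (X U W : 'M[C]_(p, q)) (psi : 'M[C]_(p * q, c)) :
  mxvec U *m psi = 0 ->
  (forall z : C,
     sqnorm (mxvec X *m psi) * sqnorm (X + z *: U + z ^+ 2 *: W) <=
     sqnorm (mxvec (X + z *: U + z ^+ 2 *: W) *m psi) * sqnorm X) ->
  sqnorm (mxvec X *m psi) * sqnorm U <= 0.
Proof.
move=> psiU Xmin.
set a := sqnorm (mxvec X *m psi); set e := sqnorm (mxvec W *m psi).
have ineq (d : R) : 0 < d -> a * sqnorm U <= d * (e * sqnorm X).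
  (* The parameter [d] is the square of the step length: z = ±r gives z^2 = d and z = ±ir gives z^2
     = -d. *)
  move=> d0; set r := Num.sqrt d.
  have r2 : (r%:C) ^+ 2 = d%:C :> C by rewrite -rmorphXn /= sqr_sqrtr ?ltW.
  have ri2 : (r%:C * 'i%C) ^+ 2 = - d%:C :> C by rewrite exprMn sqr_i r2 mulrN1.
  have sd : sqmod (d%:C : C) = d ^+ 2 by rewrite /sqmod /= expr0n addr0.
  have sr : sqmod (r%:C : C) = d by rewrite /sqmod /= expr0n addr0 sqr_sqrtr ?ltW.
  have sri : sqmod (r%:C * 'i%C : C) = d.
    by rewrite sqmodM sr /sqmod /= expr0n expr1n add0r mulr1.
  have psiY (z : C) :
      mxvec (X + z *: U + z ^+ 2 *: W) *m psi = mxvec X *m psi + z ^+ 2 *: (mxvec W *m psi).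
    by rewrite !linearD !linearZ /= !mulmxDl -!scalemxAl psiU scaler0 addr0.
  (* Adding the inequalities at z and -z removes the linear term by the parallelogram law; the
     right-hand side depends only on z^2, as [psi] kills [U]. *)
  have pair (z : C) : a * (2 * sqnorm (X + z ^+ 2 *: W) + 2 * (sqmod z * sqnorm U))
      <= 2 * sqnorm (mxvec X *m psi + z ^+ 2 *: (mxvec W *m psi)) * sqnorm X.
    have := Xmin z; have := Xmin (- z); rewrite /= !psiY sqrrN.
    rewrite -sqnormZ -sqnorm_parallelogram scaleNr !(addrAC X _ (z ^+ 2 *: W)).
    by rewrite -/a; lra.
  have := pair r%:C; have := pair (r%:C * 'i%C).
  rewrite r2 ri2 sr sri !scaleNr.
  have := sqnorm_parallelogram X (d%:C *: W).
  have := sqnorm_parallelogram (mxvec X *m psi) (d%:C *: (mxvec W *m psi)).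
  rewrite !sqnormZ sd -/a -/e.
  set x1 := sqnorm _; set x2 := sqnorm _; set x3 := sqnorm _; set x4 := sqnorm _.
  move=> E1 E2 I1 I2.
  have w0 : 0 <= a * sqnorm W by rewrite mulr_ge0 ?sqnorm_ge0.
  have : a * (2 * (2 * sqnorm X + 2 * (d ^+ 2 * sqnorm W)) + 4 * (d * sqnorm U))
         <= 2 * (2 * a + 2 * (d ^+ 2 * e)) * sqnorm X.
    by rewrite -E1 -E2; lra.
  (* The products of [a] with [sqnorm X] cancel, the nonnegative term in [W] is dropped, and a
     factor [d] can be divided out. *)
  move=> I3; rewrite -(ler_pM2l d0).
  have : 0 <= d ^+ 2 * (a * sqnorm W) by rewrite mulr_ge0 ?sqr_ge0.
  by lra.
rewrite leNgt; apply/negP => aU.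
have eX : 0 <= e * sqnorm X by rewrite mulr_ge0 ?sqnorm_ge0.
(* A step so small that [d * (e * sqnorm X)] stays below [a * sqnorm U]; the [+ 1] keeps the
   denominator positive when [e * sqnorm X] is zero. *)
have d0 : 0 < a * sqnorm U / (2 * (e * sqnorm X + 1)) by rewrite divr_gt0 //; lra.
have := ineq _ d0; rewrite leNgt => /negP; apply.
rewrite mulrAC ltr_pdivrMr; last by lra.
by rewrite ltr_pM2l //; lra.
Qed.

(* Here G is arbitrary; for a generalised inverse, E and F have rank p - \rank X
   and q - \rank X. *)
Lemma rank_curve p q (X U : 'M[C]_(p, q)) (G : 'M_(q, p)) (z : C)
    (E := 1%:M - X *m G) (F := 1%:M - G *m X) :
  (\rank (X + z *: U + z ^+ 2 *: (E *m U *m G *m X *m (G *m U)))%R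
     <= \rank X + \rank (E *m U *m F))%N.
Proof.
set A := E *m U *m G; set B := G *m U; set D := E *m U *m F.
have UE : U = X *m B + A *m X + D.
  rewrite -addrA /A /D -[E *m U *m G *m X]mulmxA -mulmxDr.
  rewrite [G *m X + F]addrC subrK mulmx1.
  by rewrite /B mulmxA -mulmxDl [X *m G + E]addrC subrK mul1mx.
(* The quadratic coefficient is the one that completes the product: the first summand has rank at
   most that of [X], and only the corner [D] adds to it. *)
have -> : X + z *: U + z ^+ 2 *: (A *m X *m B) =
    (1%:M + z *: A) *m X *m (1%:M + z *: B) + z *: D.
  rewrite {1}UE !mulmxDl !mulmxDr !mul1mx !mulmx1 -!scalemxAl -!scalemxAr.
  move: {UE} (A *m X *m B) (X *m B) (A *m X) (D) => AXB XB AX D'.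
  by apply/matrixP => i j; rewrite !mxE; ring.
apply: leq_trans (mxrank_add _ _) (leq_add _ _).
  by apply: leq_trans (mxrankM_maxl _ _) (mxrankM_maxr _ _).
by rewrite -mul_scalar_mx mxrankM_maxr.
Qed.

(** The subspace is given by [r] generators that may be dependent, and [c] rather than [c *m B] is
    required to be nonzero. This form survives the induction, where compression to a corner can
    destroy independence. *)
Theorem low_rank_in_subspace t n m r (B : 'M[C]_(r, n * m)) :
  ((n - t) * (m - t) < r)%N ->
  exists2 c : 'rV_r, c != 0 & (\rank (vec_mx (c *m B) : 'M_(n, m)) <= t)%N.
Proof.
elim/ltn_ind: t n m r B => t IH n m r B hr.
case: (pselect (exists2 c : 'rV_r, c != 0 &
  (\rank (vec_mx (c *m B) : 'M_(n, m)) <= t)%N)) => // none; exfalso.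
have r0 : (0 < r)%N by apply: leq_ltn_trans hr.
have c1 : const_mx 1 != 0 :> 'rV[C]_r.
  by apply/eqP => /rowP/(_ (Ordinal r0)) /eqP; rewrite !mxE oner_eq0.
have [n0|n0] := posnP n.
  apply: none; exists (const_mx 1) => //.
  by apply: leq_trans (rank_leq_row _) _; rewrite n0.
have [m0|m0] := posnP m.
  apply: none; exists (const_mx 1) => //.
  by apply: leq_trans (rank_leq_col _) _; rewrite m0.
(* For [t = 0] there are more generators than dimensions, so some nontrivial combination of them is
   zero. *)
have [t0|t0] := posnP t.
  have : kermx B != 0.
    rewrite -mxrank_eq0 mxrank_ker -lt0n subn_gt0.
    by apply: leq_ltn_trans (rank_leq_col _) _; move: hr; rewrite t0 !subn0.
  case/rowV0Pn => c /sub_kermxP cB c0; apply: none; exists c => //.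
  by rewrite cB linear0 mxrank0.
(* The kernel of [psi] is the row space of [B]; by [none] it contains no nonzero matrix of rank at
   most [t]. *)
pose psi := cokermx B.
have psi0 (Y : 'M[C]_(n, m)) : (\rank Y <= t)%N -> mxvec Y *m psi = 0 -> Y = 0.
  move=> rY /eqP; rewrite -submxE => /submxP[c cE].
  case: (eqVneq c 0) => [c0|c0]; first by rewrite -[Y]mxvecK cE c0 mul0mx linear0.
  by case: none; exists c; rewrite // -cE mxvecK.
have [X [X0 rX Xmin]] := low_rank_minimizer psi t0 n0 m0.
have s0 : (0 < \rank X)%N by rewrite lt0n mxrank_eq0.
pose G := pinvmx X; pose E := 1%:M - X *m G; pose F := 1%:M - G *m X.
have XGX : X *m G *m X = X by rewrite mulmxKpV.
have rE : (\rank E + \rank X <= n)%N.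
  by apply: mulmx0_rank_max; rewrite mulmxBl mul1mx XGX subrr.
have rF : (\rank X + \rank F <= m)%N.
  by apply: mulmx0_rank_max; rewrite mulmxBr mulmx1 mulmxA XGX subrr.
pose f := mulmxr (col_base F) \o mulmx (row_base E) : 'M[C]_(n, m) -> 'M_(\rank E, \rank F).
(* The corner has at most [n - \rank X] rows and [m - \rank X] columns, so lowering [t] by [\rank X]
   does not increase the product to be beaten. It is a strict decrease of [t] because [X] is
   nonzero. *)
have [||c c0] := IH (t - \rank X)%N _ (\rank E) (\rank F) r (B *m lin_mx f).
- by lia.
- apply: leq_ltn_trans hr; apply: leq_mul; lia.
rewrite mulmxA -[c *m B]vec_mxK mul_vec_lin mxvecK /=.
set U := vec_mx (c *m B) => rU.
have EUF : (\rank (E *m U *m F) <= t - \rank X)%N.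
  have -> : E *m U *m F =
      col_base E *m (row_base E *m U *m col_base F) *m row_base F.
    by rewrite -{1}(mulmx_base E) -{1}(mulmx_base F) !mulmxA.
  apply: leq_trans rU; apply: leq_trans (mxrankM_maxl _ _) _.
  exact: mxrankM_maxr.
have U0 : U != 0.
  by apply/eqP => UE; apply: none; exists c; rewrite // -/U UE mxrank0.
have psiU : mxvec U *m psi = 0.
  by apply/eqP; rewrite -submxE vec_mxK submxMl.
have psiX : mxvec X *m psi != 0.
  by apply: contraNneq X0 => /(psi0 _ rX) ->.
(* With the [W] of [rank_curve] the whole curve has rank at most [t], so minimality of [X] applies
   for every z, while both factors of the bounded product are positive. *)
have := second_variation (W := E *m U *m G *m X *m (G *m U)) psiU.
move=> /(_ X); rewrite leNgt mulr_gt0 ?sqnorm_gt0 // => /(_ _)/negP; apply => //.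
move=> z; apply: Xmin; apply: leq_trans (rank_curve _ _ _ _) _.
by apply: leq_trans (leq_add (leqnn _) EUF) _; rewrite subnKC.
Qed.
End DimensionTheorem.

(** * Averages over subsets, Cauchy-Schwarz, and ranks of idempotents *)

Lemma card_supersets (T : finType) (A : {set T}) k : (k <= #|T|)%N ->
  #|[set S : {set T} | A \subset S & #|S| == k]| = 'C(#|T| - #|A|, #|T| - k).
Proof.
move=> kT; rewrite -(@card_imset _ _ (@finset.setC T)); last exact: inv_inj (@finset.setCK T).
have -> : (#|T| - #|A| = #|~: A|)%N by rewrite -(cardsC A) addKn.
rewrite -cards_draws; congr #|pred_of_set _|; apply/setP=> S.
apply/imsetP/idP => [[S' + ->]|].
  by rewrite !inE finset.setCS [#|~: S'|]cardsCs finset.setCK => /andP[-> /eqP ->] /=.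
rewrite inE => /andP[SA /eqP cS]; exists (~: S); rewrite ?finset.setCK // inE.
by rewrite finset.subsetC SA cardsCs finset.setCK cS subKn //= eqxx.
Qed.

Section SubsetAverages.
Variables (R : realFieldType) (p k : nat).
Hypothesis kp : (k <= p)%N.

Definition sum_subsets (F : {set 'I_p} -> R) := \sum_(S : {set 'I_p} | #|S| == k) F S.

(** The lower index [p - k] gives the correct value 0 when [k < #|A|], whereas a truncated
    [k - #|A|] would give 1. This matters for pairs when [k = 1]. *)
Lemma sum_subsets_supset (A : {set 'I_p}) :
  sum_subsets (fun S => (A \subset S)%:R) = 'C(p - #|A|, p - k)%:R.
Proof.
rewrite -[p in (p - #|A|)%N]card_ord -[p in (p - k)%N]card_ord -card_supersets ?card_ord //.
rewrite /sum_subsets -sum1_card natr_sum big_mkcond [RHS]big_mkcond.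
by apply: eq_bigr => S _; rewrite inE; case: (A \subset S); case: (#|S| == k).
Qed.

Lemma sum_subsets1 (i : 'I_p) :
  sum_subsets (fun S => (i \in S)%:R) = 'C(p.-1, p - k)%:R.
Proof.
rewrite -subn1 -(cards1 i) -sum_subsets_supset.
by apply: eq_bigr => S _; rewrite finset.sub1set.
Qed.

Lemma sum_subsets2 (i j : 'I_p) : i != j ->
  sum_subsets (fun S => (i \in S)%:R * (j \in S)%:R) = 'C(p.-2, p - k)%:R.
Proof.
move=> ij; have -> : (p.-2 = p - #|[set i; j]|)%N by rewrite cards2 ij subn2.
rewrite -sum_subsets_supset; apply: eq_bigr => S _.
by rewrite finset.subUset !finset.sub1set -natrM mulnb.
Qed.

Lemma sum_subsets0 : \sum_(S : {set 'I_p} | #|S| == k) 1 = 'C(p, p - k)%:R :> R.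
Proof.
have := sum_subsets_supset finset.set0; rewrite cards0 subn0 => <-.
by apply: eq_bigr => S _; rewrite finset.sub0set.
Qed.

End SubsetAverages.

(** Cauchy-Schwarz against the constant 1, by expanding the sum of the squares of [N * x i - T]. *)
Lemma sqr_sum_le (R : realFieldType) (I : finType) (P : pred I) (x : I -> R) :
  (\sum_(i | P i) x i) ^+ 2 <= (\sum_(i | P i) 1) * \sum_(i | P i) x i ^+ 2.
Proof.
set T := \sum_(i | P i) x i; set N := \sum_(i | P i) 1; set Q := \sum_(i | P i) x i ^+ 2.
have N0 : 0 <= N by apply: sumr_ge0.
have : 0 <= \sum_(i | P i) (N * x i - T) ^+ 2 by apply: sumr_ge0 => i _; exact: sqr_ge0.
have -> : \sum_(i | P i) (N * x i - T) ^+ 2 = N * (N * Q - T ^+ 2).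
  under eq_bigr => i _.
    have -> : (N * x i - T) ^+ 2 = N ^+ 2 * x i ^+ 2 + (- 2 * N * T * x i + T ^+ 2 * 1) by ring.
    over.
  by rewrite !big_split /= -!mulr_sumr -/T -/N -/Q; ring.
(* If [N] is zero then [P] selects no index and both sides vanish. *)
have [N00|Npos] := eqVneq N 0; last first.
  by rewrite pmulr_rge0 ?subr_ge0 // lt0r Npos.
move=> _; have -> : T = 0; last by rewrite expr0n /= N00 mul0r.
apply: big1 => i Pi; move/eqP: N00; rewrite psumr_eq0 // => /allP /(_ i (mem_index_enum _)).
by rewrite Pi /= oner_eq0.
Qed.

Lemma mxrank_sum_le (F : fieldType) (I : finType) (P : pred I) p q (A : I -> 'M[F]_(p, q)) :
  (\rank (\sum_(i | P i) A i)%R <= \sum_(i | P i) \rank (A i))%N.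
Proof.
elim/big_rec2: _ => [|i r B _ rB]; first by rewrite mxrank0.
by apply: leq_trans (mxrank_add _ _) _; rewrite leq_add2l.
Qed.

(** In a full-rank factorisation Q = cb, cancelling c on the left and b on the right of cbcb = cb
    gives bc = 1, and Q has the trace of bc. *)
Lemma mxtrace_idempotent (F : fieldType) N (Q : 'M[F]_N) :
  Q *m Q = Q -> \tr Q = (\rank Q)%:R.
Proof.
move=> QQ; have [L LC] := row_fullP (col_base_full Q).
have [M BM] := row_freeP (row_base_free Q).
move: (col_base Q) (row_base Q) (mulmx_base Q) L M LC BM.
move: (\rank Q) => r c b QE L M LC BM.
rewrite -QE mxtrace_mulC; have -> : b *m c = L *m (Q *m Q) *m M.
  by rewrite -QE !mulmxA LC mul1mx -!mulmxA BM mulmx1.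
by rewrite QQ -QE !mulmxA LC mul1mx BM mxtrace1.
Qed.

(** * Coordinate projections *)

Section Selection.
Variable R : realType.
Local Notation C := R[i].

Definition sel p (S : {set 'I_p}) : 'M[C]_p := diag_mx (\row_i (i \in S)%:R).

Lemma mxadj_sel p (S : {set 'I_p}) : mxadj (sel S) = sel S.
Proof.
apply/matrixP=> i j; rewrite !mxE eq_sym rmorphMn /= conjc_nat.
by case: eqP => // ->.
Qed.

Lemma sel_idem p (S : {set 'I_p}) : sel S *m sel S = sel S.
Proof.
rewrite /sel mulmx_diag; congr diag_mx; apply/rowP=> i; rewrite !mxE.
by rewrite -natrM mulnb andbb.
Qed.

Lemma mxrank_sel p (S : {set 'I_p}) : (\rank (sel S) <= #|S|)%N.
Proof.
rewrite /sel diag_mx_sum_delta (bigID (mem S)) /= [X in (_ + X)%R]big1 ?addr0; last first.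
  by move=> i iS; rewrite mxE (negbTE iS) scale0r.
apply: leq_trans (mxrank_sum_le _ _) _; rewrite -sum1_card.
apply: leq_sum => i iS; rewrite mxE iS scale1r mxrank_delta.
by [].
Qed.

Lemma sqnorm_sel p q (Y : 'M[C]_(p, q)) (S : {set 'I_q}) :
  sqnorm (Y *m sel S) = \sum_j (j \in S)%:R * (\sum_i sqmod (Y i j)).
Proof.
rewrite /sqnorm exchange_big; apply: eq_bigr => j _.
rewrite mulr_sumr; apply: eq_bigr => i _; rewrite mul_mx_diag !mxE sqmodM mulrC.
by congr (_ * _); case: (j \in S); rewrite /sqmod /= ?expr0n ?expr1n !addr0.
Qed.

End Selection.

(** * Lower bounds for the S(k)-norm of a projection *)

Section SchmidtNorm.
Variable R : realType.
Local Notation C := R[i].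

Lemma unit_vec_le1 N (v : 'rV[C]_N) j : unit_vec v -> `|v 0 j| <= 1.
Proof.
move=> v1; rewrite -(@expr_le1 _ 2) // -v1 (bigD1 j) //= lerDl.
by apply: sumr_ge0 => i _; rewrite exprn_ge0.
Qed.

(** [sup] dominates the elements only of a set that is bounded above. Entries of unit vectors have
    modulus at most 1, so the sum of the moduli of the entries of [X] is a bound. *)
Lemma SNorm_ub n m k (X : 'M[C]_(n * m)) (v w : 'rV[C]_(n * m)) :
  unit_vec v -> unit_vec w -> (schmidt_rank n m v <= k)%N ->
  (schmidt_rank n m w <= k)%N -> complex.Re `|braket w X v| <= SNorm n m k X.
Proof.
move=> v1 w1 rv rw; apply: ub_le_sup.
  exists (complex.Re (\sum_i \sum_j `|X i j|)) => x [v' [w' [v1' w1' _ _ xE]]].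
  suff : x%:C <= \sum_i \sum_j `|X i j| by rewrite lecE => /andP[].
  rewrite xE /braket mxE exchange_big.
  apply: le_trans (ler_norm_sum _ _ _) (ler_sum _ _) => j _.
  rewrite normrM !mxE; apply: le_trans (ler_piMr _ _) _ => //; first exact: unit_vec_le1.
  apply: le_trans (ler_norm_sum _ _ _) (ler_sum _ _) => i _.
  rewrite normrM !mxE normcJ; apply: ler_piMl => //; exact: unit_vec_le1.
exists v, w; split=> //; rewrite RRe_real.
Qed.

Lemma schmidt_rankZ n m (z : C) (w : 'rV[C]_(n * m)) :
  (schmidt_rank n m (z *: w) <= schmidt_rank n m w)%N.
Proof. by rewrite /schmidt_rank linearZ /= -mul_scalar_mx mxrankM_maxr. Qed.

Section Projection.
Variables (n m k : nat) (P : 'M[C]_(n * m)).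
Hypotheses (Ph : mxadj P = P) (PP : P *m P = P).

Let Qh : mxadj P^T = P^T.
Proof. by rewrite -{2}Ph /mxadj trmxK map_trmx trmxK. Qed.

Let QQ : P^T *m P^T = P^T.
Proof. by rewrite -trmx_mul PP. Qed.

Lemma sqnorm_proj_le (w : 'rV[C]_(n * m)) : (schmidt_rank n m w <= k)%N ->
  sqnorm (w *m P^T) <= SNorm n m k P * sqnorm w.
Proof.
move=> rw; have [->|w0] := eqVneq w 0.
  by rewrite mul0mx (_ : sqnorm 0 = 0) ?mulr0 //; apply/eqP; rewrite sqnorm_eq0.
have [z z1] := exists_normalizing_scalar w0.
have zw1 : unit_vec (z *: w) by apply/unit_vecE; rewrite sqnormZ.
have rzw := leq_trans (schmidt_rankZ z w) rw.
have := SNorm_ub P zw1 zw1 rzw rzw.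
rewrite braket_proj // ger0_norm ?ler0c ?sqnorm_ge0 //= -scalemxAl sqnormZ.
move=> /(ler_wpM2r (sqnorm_ge0 w)); apply: le_trans.
by rewrite mulrAC z1 mul1r.
Qed.

(** The inner product of [v] and its truncation [w] is s = |w|^2, so |w - sv|^2 = s - s^2. As [v] is
    fixed by the projection, the part of [w] outside the range is that of w - sv, which leaves at
    least s^2 inside. *)
Lemma projection_overlap (v w : 'rV[C]_(n * m)) (D : 'M[C]_m) :
  mxadj D = D -> D *m D = D -> v *m P^T = v -> sqnorm v = 1 ->
  w = mxvec (vec_mx v *m D) -> sqnorm w ^+ 2 <= sqnorm (w *m P^T).
Proof.
move=> Dh DD vQ v1 wE; set s := sqnorm w.
have w_perp : sqnorm (w - s%:C *: v) = s - s ^+ 2.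
  have vD (a b : C) : sqnorm (mxvec (a *: (vec_mx v *m D) + b *: (vec_mx v *m (1%:M - D)))) =
      sqmod a * s + sqmod b * sqnorm (vec_mx v *m (1%:M - D)).
    by rewrite sqnorm_mxvec !scalemxAl pythagoras // -!scalemxAl !sqnormZ /s wE sqnorm_mxvec.
  have sq (a : R) : sqmod (a%:C : C) = a ^+ 2 by rewrite /sqmod /= expr0n addr0.
  have vE a b : a *: (vec_mx v *m D) + b *: (vec_mx v *m (1%:M - D)) =
      (a - b) *: (vec_mx v *m D) + b *: vec_mx v :> 'M[C]_(n, m).
    by rewrite mulmxBr mulmx1 scalerBr scalerBl addrA addrAC.
  have := vD 1%:C 1%:C; rewrite vE subrr scale0r add0r scale1r vec_mxK v1.
  (* These coefficients represent w - sv; the pair (1, 1) just above represents [v] and fixes the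
     norm of the complementary part as 1 - s. *)
  have := vD (1 - s)%:C (- s)%:C; rewrite vE !sq rmorphB rmorphN /= opprK subrK scale1r.
  rewrite linearD linearZ /= vec_mxK -wE scaleNr => -> E.
  by move: E; rewrite !expr1n !mul1r; nra.
have := sqnorm_split (w - s%:C *: v) Qh QQ; rewrite w_perp.
have := sqnorm_split w Qh QQ; rewrite -/s.
have -> : (w - s%:C *: v) *m (1%:M - P^T) = w *m (1%:M - P^T).
  by rewrite mulmxBl -scalemxAl [v *m _]mulmxBr mulmx1 vQ subrr scaler0 subr0.
have := sqnorm_ge0 ((w - s%:C *: v) *m P^T).
by lra.
Qed.

Lemma schmidt_truncation (v : 'rV[C]_(n * m)) :
  v *m P^T = v -> sqnorm v = 1 -> (0 < k <= schmidt_rank n m v)%N ->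
  k%:R <= (schmidt_rank n m v)%:R * SNorm n m k P.
Proof.
move=> vQ v1; rewrite /schmidt_rank; set X := vec_mx v; move=> /andP[k0 kp].
set p := \rank X; set s := SNorm n m k P.
(* An orthonormal basis of the row space of [X] suffices in place of a singular value decomposition:
   keeping [k] of its coordinates leaves rank at most [k]. *)
pose U : 'M[C]_(p, m) := schmidt (row_base X).
have UU : U *m mxadj U = 1%:M.
  have /unitarymxP <- := schmidt_unitarymx (row_base X) (rank_leq_col X).
  by congr (_ *m _); rewrite /mxadj map_trmx.
have XU : X *m mxadj U *m U = X.
  have /submxP[Z ->] : (X <= U)%MS.
    by rewrite (eqmx_schmidt_free (row_base_free X)) eq_row_base.
  by rewrite -!mulmxA (mulmxA U) UU mul1mx.
pose Y := X *m mxadj U; pose a j := \sum_i sqmod (Y i j).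
pose D S := mxadj U *m sel R S *m U.
have sD S : sqnorm (mxvec (X *m D S)) = \sum_j (j \in S)%:R * a j.
  by rewrite sqnorm_mxvec /D !mulmxA sqnorm_isometry // sqnorm_sel.
have a1 : \sum_j a j = 1.
  by rewrite -v1 -[v]vec_mxK sqnorm_mxvec -/X -XU sqnorm_isometry // /sqnorm exchange_big.
have trunc (S : {set 'I_p}) : #|S| == k ->
    (\sum_j (j \in S)%:R * a j) ^+ 2 <= s * \sum_j (j \in S)%:R * a j.
  move=> /eqP Sk; rewrite -sD.
  apply: (le_trans (projection_overlap (v := v) (D := D S) _ _ vQ v1 erefl)).
  - by rewrite /D !mxadjM mxadj_sel mxadjK mulmxA.
  - by rewrite /D -!mulmxA (mulmxA U) UU mul1mx (mulmxA (sel R S) (sel R S)) sel_idem.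
  apply: sqnorm_proj_le; rewrite /schmidt_rank mxvecK /D -Sk !mulmxA.
  apply: leq_trans (mxrankM_maxl _ _) _.
  exact: leq_trans (mxrankM_maxr _ _) (mxrank_sel _ _).
have c1E : \sum_(S : {set 'I_p} | #|S| == k) \sum_j (j \in S)%:R * a j = 'C(p.-1, p - k)%:R.
  rewrite exchange_big /=; transitivity ('C(p.-1, p - k)%:R * \sum_j a j); last by rewrite a1 mulr1.
  rewrite mulr_sumr; apply: eq_bigr => j _.
  by rewrite -mulr_suml; congr (_ * _); exact: (sum_subsets1 R kp j).
have := sqr_sum_le (fun S : {set 'I_p} => #|S| == k) (fun S => \sum_j (j \in S)%:R * a j).
rewrite c1E (sum_subsets0 R kp).
have : \sum_(S : {set 'I_p} | #|S| == k) (\sum_j (j \in S)%:R * a j) ^+ 2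
      <= s * 'C(p.-1, p - k)%:R.
  by rewrite -c1E mulr_sumr; apply: ler_sum.
set c1 : R := 'C(p.-1, p - k)%:R; set c0 : R := 'C(p, p - k)%:R; set q := \sum_(_ | _) _.
have c0_gt0 : 0 < c0 by rewrite ltr0n bin_gt0 leq_subr.
have c1_gt0 : 0 < c1 by rewrite ltr0n bin_gt0; lia.
have c10 : p%:R * c1 = k%:R * c0.
  by rewrite -!natrM mul_bin_down subKn.
(* Cauchy-Schwarz over the subsets gives c1^2 <= c0 s c1, hence c1 <= c0 s; the ratio c1 / c0 is k /
   p by [c10]. *)
move=> q_le /le_trans /(_ (ler_wpM2l (ltW c0_gt0) q_le)).
rewrite mulrA expr2 (ler_pM2r c1_gt0) => c1_le.
rewrite -(ler_pM2r c0_gt0) -c10 -mulrA ler_wpM2l // mulrC //.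
Qed.

Lemma average_bound : (0 < k <= m)%N -> (2 <= m)%N -> (0 < n)%N -> P != 0 ->
  (((k - 1)%:R : R) * m%:R * n%:R + (m - k)%:R * (\rank P)%:R)
     / (m%:R * n%:R * (m - 1)%:R) <= SNorm n m k P.
Proof.
move=> /andP[k0 km] m2 n0 P0; set r := (\rank P)%:R; set s := SNorm n m k P.
pose Q := P^T; pose N := (n * m)%N.
have Q_idem : Q *m Q = Q := QQ.
have trQ : \tr Q = r%:C by rewrite mxtrace_idempotent // mxrank_tr rmorph_nat.
(* The indicator that the column part of the composite index [b] lies in [S]. *)
pose e (S : {set 'I_m}) (b : 'I_N) : R := mxvec (\matrix_(i < n, j < m) (j \in S)%:R) 0 b.
have eE S i j : e S (mxvec_index i j) = (j \in S)%:R by rewrite /e mxvecE mxE.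
pose E S : 'M[C]_N := diag_mx (\row_b (e S b)%:C).
have e2 S b : e S b ^+ 2 = e S b.
  by case/mxvec_indexP: b => i j; rewrite eE; case: (j \in S); rewrite ?expr1n ?expr0n.
have vE S (v : 'rV[C]_N) : v *m E S = mxvec (vec_mx v *m sel R S).
  apply/rowP => b; case/mxvec_indexP: b => i j.
  rewrite mul_mx_diag mxvecE mul_mx_diag !mxE eE; congr (_ * _).
  by case: (j \in S).
(* Each row of [Q *m E S] has a coefficient matrix supported on the columns in [S], so its Schmidt
   rank is at most [k]. *)
have sum_w (S : {set 'I_m}) : #|S| == k -> sqnorm (Q *m E S *m Q) <= s * sqnorm (Q *m E S).
  move=> /eqP Sk; rewrite !(sqnorm_rows (Q *m _)) sqnorm_rows mulr_sumr.
  apply: ler_sum => a _; rewrite !row_mul; apply: sqnorm_proj_le.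
  rewrite vE /schmidt_rank mxvecK -Sk.
  exact: leq_trans (mxrankM_maxr _ _) (mxrank_sel _ _).
have QES S : sqnorm (Q *m E S) = \sum_a \sum_b sqmod (Q a b) * e S b.
  apply: eq_bigr => a _; apply: eq_bigr => b _; rewrite mul_mx_diag !mxE sqmodM.
  by rewrite {2}/sqmod /= expr0n addr0 e2.
have QESQ S : sqnorm (Q *m E S *m Q) = \sum_a \sum_b sqmod (Q a b) * (e S a * e S b).
  have Eh : mxadj (E S) = E S.
    apply/matrixP=> i j; rewrite !mxE eq_sym rmorphMn.
    case: eqP => [->|_]; last by rewrite !mulr0n.
    by rewrite !mulr1n; apply: conjc_real.
  apply: (@complexI R); transitivity (\tr ((Q *m E S) *m (Q *m E S))).
    rewrite sqnormE !mxadjM Qh Eh -/Q -!mulmxA (mulmxA Q Q) Q_idem mxtrace_mulC -!mulmxA.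
    by rewrite Q_idem mxtrace_mulC -!mulmxA.
  rewrite rmorph_sum; apply: eq_bigr => a _; rewrite rmorph_sum mxE.
  apply: eq_bigr => b _; rewrite !mul_mx_diag !mxE !rmorphM /= sqmodE.
  have -> : P a b = conjc (P b a) by rewrite -{1}Ph !mxE.
  by ring.
have sqQ : sqnorm Q = r.
  by apply: (@complexI R); rewrite sqnormE Qh -/Q Q_idem trQ.
pose c1 : R := 'C(m.-1, m - k)%:R; pose c2 : R := 'C(m.-2, m - k)%:R.
have c1_gt0 : 0 < c1 by rewrite ltr0n bin_gt0; lia.
have c21 : (m - 1)%:R * c2 = (k - 1)%:R * c1.
  rewrite -!natrM subn1 mul_bin_down; congr (_ * _)%:R; lia.
have c2_le : c2 <= c1.
  have m1 : 0 < (m - 1)%:R :> R by rewrite ltr0n; lia.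
  by rewrite -(ler_pM2l m1) c21 ler_pM2r // ler_nat; lia.
have sum_e b : sum_subsets k (fun S => e S b) = c1.
  case/mxvec_indexP: b => i j; rewrite /c1 -(sum_subsets1 R km j).
  by apply: eq_bigr => S _; rewrite eE.
(* Distinct indices may share their column; they are then counted [c1] times, which is still at
   least [c2]. *)
have sum_ee a b : c2 + (c1 - c2) * (a == b)%:R <= sum_subsets k (fun S => e S a * e S b).
  have [<-|ab] := eqVneq a b.
    rewrite mulr1 addrC subrK -(sum_e a); apply: ler_sum => S _.
    by rewrite -expr2 e2.
  rewrite mulr0 addr0; move: ab.
  case/mxvec_indexP: a => i j; case/mxvec_indexP: b => i' j' _.
  have [<-|jj] := eqVneq j j'.
    apply: le_trans c2_le _; rewrite -(sum_e (mxvec_index i j)).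
    by apply: ler_sum => S _; rewrite !eE -expr2 -(eE S i j) e2.
  by rewrite /c2 -(sum_subsets2 R km jj); apply: ler_sum => S _; rewrite !eE.
(* The trace of [Q] is its rank, and Cauchy-Schwarz is applied to the real parts of the diagonal. *)
have diag_ge : r ^+ 2 <= N%:R * \sum_a sqmod (Q a a).
  have -> : r = \sum_a complex.Re (Q a a).
    rewrite -[r]/(complex.Re r%:C) -trQ /mxtrace.
    by elim/big_rec2: _ => // a x y _ <-; case: (Q a a); case: y.
  apply: le_trans (sqr_sum_le _ _) _; rewrite sumr_const card_ord ler_wpM2l //.
  by apply: ler_sum => a _; rewrite lerDl sqr_ge0.
have up : sum_subsets k (fun S => sqnorm (Q *m E S *m Q)) <= s * (c1 * r).
  have -> : c1 * r = sum_subsets k (fun S => sqnorm (Q *m E S)).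
    rewrite -sqQ /sum_subsets; under [RHS]eq_bigr => S _ do rewrite QES.
    rewrite exchange_big mulr_sumr; apply: eq_bigr => a _.
    rewrite exchange_big mulr_sumr; apply: eq_bigr => b _.
    by rewrite -(sum_e b) mulrC mulr_sumr.
  by rewrite mulr_sumr; apply: ler_sum.
have low : c2 * r + (c1 - c2) * \sum_a sqmod (Q a a)
    <= sum_subsets k (fun S => sqnorm (Q *m E S *m Q)).
  rewrite /sum_subsets; under [leRHS]eq_bigr => S _ do rewrite QESQ.
  rewrite exchange_big -sqQ !mulr_sumr -big_split; apply: ler_sum => a _ /=.
  rewrite exchange_big mulr_sumr.
  have -> : (c1 - c2) * sqmod (Q a a) = \sum_b sqmod (Q a b) * ((c1 - c2) * (a == b)%:R).
    rewrite (bigD1 a) //= big1 ?addr0 ?eqxx ?mulr1 1?mulrC // => b ba.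
    by rewrite eq_sym (negbTE ba) !mulr0.
  rewrite -big_split; apply: ler_sum => b _ /=.
  by rewrite -mulr_sumr [c2 * _]mulrC -mulrDr ler_wpM2l ?sqmod_ge0 //; apply: sum_ee.
have r_gt0 : 0 < r by rewrite ltr0n lt0n mxrank_eq0.
have m_gt0 : 0 < m%:R :> R by rewrite ltr0n; lia.
have n_gt0 : 0 < n%:R :> R by rewrite ltr0n.
have m1_gt0 : 0 < (m - 1)%:R :> R by rewrite ltr0n subn_gt0.
have NE : N%:R = n%:R * m%:R :> R by rewrite natrM.
have mkE : (m - k)%:R = (m - 1)%:R - (k - 1)%:R :> R.
  by rewrite -natrB ?leq_sub2r // subnBA // subnK // ltnW.
rewrite ler_pdivrMr ?mulr_gt0 //.
move: diag_ge (le_trans low up); rewrite NE mkE; set d := \sum_a _.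
move=> rd ineq.
have N_gt0 : 0 < n%:R * m%:R :> R by rewrite mulr_gt0.
have {}ineq : c2 * r * (n%:R * m%:R) + (c1 - c2) * r ^+ 2 <= s * (c1 * r) * (n%:R * m%:R).
  apply: le_trans (ler_wpM2r (ltW N_gt0) ineq).
  rewrite [leRHS]mulrDl lerD2l -mulrA ler_wpM2l ?subr_ge0 //; lra.
have {}ineq : c2 * (n%:R * m%:R) + (c1 - c2) * r <= s * c1 * (n%:R * m%:R).
  by rewrite -(ler_pM2r r_gt0); lra.
(* Multiplying by [(m - 1)%:R] allows [c21] to eliminate [c2]: (m - 1)(c1 - c2) becomes (m - k)
   c1. *)
rewrite -(ler_pM2r c1_gt0).
apply: le_trans (_ : (m - 1)%:R * (c2 * (n%:R * m%:R) + (c1 - c2) * r) <= _); last first.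
  by apply: le_trans (ler_wpM2l (ltW m1_gt0) ineq) _; lra.
have -> : (m - 1)%:R * (c2 * (n%:R * m%:R) + (c1 - c2) * r) =
    (m - 1)%:R * c2 * (n%:R * m%:R) + (m - 1)%:R * c1 * r - (m - 1)%:R * c2 * r by ring.
by rewrite c21; lra.
Qed.
End Projection.
End SchmidtNorm.

(** * The threshold in the first bound, and the conclusion *)

Lemma ceil_low_rank (R : realType) (n m r : nat) :
  (m <= n)%N -> (0 < r <= n * m)%N ->
  exists t : nat, [/\ (0 < t)%N, ((n - t) * (m - t) < r)%N &
    Num.ceil ((n%:R + m%:R - Num.sqrt ((n%:R - m%:R) ^+ 2 + 4 * r%:R - 4)) / 2 : R)
      = t%:Z].
Proof.
move=> mn /andP[r0 rnm].
(* [T] is the smaller root of (n - x)(m - x) = r - 1, and [d] is the discriminant; hence any integer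
   from [T] to [m] has the required property. *)
set d : R := (n%:R - m%:R) ^+ 2 + 4 * r%:R - 4; set T : R := (_ / 2).
have r1 : 1 <= r%:R :> R by rewrite ler1n.
have mnR : m%:R <= n%:R :> R by rewrite ler_nat.
have rnmR : r%:R <= n%:R * m%:R :> R by rewrite -natrM ler_nat.
have d_ge : (n%:R - m%:R) ^+ 2 <= d by rewrite /d; lra.
have d0 : 0 <= d by apply: le_trans (sqr_ge0 _) d_ge.
have sd : Num.sqrt d ^+ 2 = d by rewrite sqr_sqrtr.
have s0 : 0 <= Num.sqrt d := sqrtr_ge0 d.
have nm0 : 0 <= n%:R + m%:R :> R by rewrite addr_ge0.
have s_lt : Num.sqrt d < n%:R + m%:R.
  rewrite -(ltr_pXn2r (ltn0Sn 1)) ?nnegrE // sd /d; nra.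
have s_ge : n%:R - m%:R <= Num.sqrt d.
  rewrite -(ler_pXn2r (ltn0Sn 1)) ?nnegrE ?subr_ge0 // sd //.
have T0 : 0 < T by rewrite /T; lra.
have Tm : T <= m%:R by rewrite /T; lra.
have c0 : 0 < Num.ceil T by rewrite ceil_gt_int.
exists `|Num.ceil T|%N.
have tE : Num.ceil T = `|Num.ceil T|%N%:Z by rewrite gez0_abs // ltW.
have tR : (Num.ceil T)%:~R = `|Num.ceil T|%N%:R :> R by rewrite {1}tE.
have tm : (`|Num.ceil T| <= m)%N by rewrite -lez_nat -tE ceil_le_int.
have Tt : T <= `|Num.ceil T|%N%:R by rewrite -tR ceil_ge.
split=> //; first by rewrite absz_gt0 gt_eqF.
move: tm Tt; move: (`|Num.ceil T|%N) => t tm Tt.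
rewrite -(ltr_nat R) natrM !natrB ?(leq_trans tm) //.
have tmR : t%:R <= m%:R :> R by rewrite ler_nat.
(* The left side equals (n - m)^2 + 4(n - t)(m - t), so this says (n - t)(m - t) <= r - 1. *)
have : (n%:R + m%:R - 2 * t%:R) ^+ 2 <= d.
  have t_ge : 0 <= n%:R + m%:R - 2 * t%:R :> R by lra.
  have t_le : n%:R + m%:R - 2 * t%:R <= Num.sqrt d by move: Tt; rewrite /T; lra.
  by rewrite -sd ler_pXn2r ?nnegrE.
by rewrite /d; nra.
Qed.

Lemma low_rank_eigenvector (R : realType) (n m t : nat) (P : 'M[R[i]]_(n * m)) :
  P *m P = P -> ((n - t) * (m - t) < \rank P)%N ->
  exists v : 'rV_(n * m),
    [/\ v *m P^T = v, sqnorm v = 1 & (schmidt_rank n m v <= t)%N].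
Proof.
(* Generating the range by the independent rows of [row_base] ensures that a nonzero [c] yields a
   nonzero vector. *)
rewrite -mxrank_tr => PP /(@low_rank_in_subspace _ _ _ _ _ (row_base P^T)) [c c0 rc].
have v0 : c *m row_base P^T != 0 by rewrite mulmx_free_eq0 ?row_base_free.
have [z z1] := exists_normalizing_scalar v0; exists (z *: (c *m row_base P^T)); split.
- have /submxP[Z ->] : (z *: (c *m row_base P^T) <= P^T)%MS.
    by apply: scalemx_sub; apply: submx_trans (submxMl _ _) _; rewrite eq_row_base.
  by rewrite -mulmxA -trmx_mul PP.
- by rewrite sqnormZ.
- exact: leq_trans (schmidt_rankZ _ _) rc.
Qed.

Theorem theorem4p15 (R : realType) (n m k : nat) (P : 'M[R[i]]_(n * m)) :
  (2 <= m)%N -> (m <= n)%N -> (1 <= k)%N -> (k <= m)%N ->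
  P != 0 -> mxadj P = P -> P *m P = P ->
  Num.min (1 : R) (k%:R / (Num.ceil ((n%:R + m%:R
       - Num.sqrt ((n%:R - m%:R) ^+ 2 + 4 * (\rank P)%:R - 4)) / 2 : R))%:~R)
    <= SNorm n m k P
  /\
  (((k - 1)%:R : R) * m%:R * n%:R + (m - k)%:R * (\rank P)%:R)
     / (m%:R * n%:R * (m - 1)%:R) <= SNorm n m k P.
Proof.
move=> m2 mn k1 km P0 Ph PP; split; last by apply: average_bound => //; [exact/andP|lia].
have [|t [t0 tr ->]] := @ceil_low_rank R n m (\rank P) mn.
  by rewrite lt0n mxrank_eq0 P0 rank_leq_row.
have [v [vQ v1 vt]] := low_rank_eigenvector PP tr.
(* If [v] already has Schmidt rank at most [k], it is admissible and the norm is at least 1;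
   otherwise its truncations give [k] over its Schmidt rank. *)
have [vk|kv] := leqP (schmidt_rank n m v) k.
  have := sqnorm_proj_le Ph PP vk; rewrite vQ v1 mulr1 => S1.
  by rewrite ge_min S1.
have := @schmidt_truncation _ n m k P Ph PP v vQ v1 _.
rewrite k1 ltnW // => /(_ isT) kS.
(* Nonnegativity is what permits replacing the Schmidt rank of [v] by the larger [t]. *)
have S0 : 0 <= SNorm n m k P.
  rewrite -(@pmulr_rge0 _ (schmidt_rank n m v)%:R); last by rewrite ltr0n; lia.
  exact: le_trans kS.
rewrite ge_min ler_pdivrMr ?ltr0n // mulrC (le_trans kS) ?orbT //.
by rewrite ler_wpM2r // ler_nat.
Qed.
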